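(* Let $\mathcal{F}=(F;\mu,\eta,\delta,\epsilon)$ be a Frobenius algebra in $\mathbf{Rel}$. Then the corresponding $\epsilon$-simplicial set $N(\mathcal{F})$ has the unique extension property with respect to the inclusions $\Lambda^n_{\epsilon,0}\subset\Delta_\epsilon^n$ and $\Lambda^n_{\epsilon,n}\subset\Delta_\epsilon^n$ for all $n\geq 1$; that is, every morphism $\Lambda^n_{\epsilon,i}\to N(\mathcal{F})$ with $n\ge1$ and $i\in\{0,n\}$ extends uniquely to a morphism $\Delta_\epsilon^n\to N(\mathcal{F})$.
   Context: **Monoids and Frobenius algebras in $\mathbf{Rel}$.** $\mathbf{Rel}$ is the category of sets and binary relations, monoidal under the cartesian product $\times$ with unit a one-element set $\{\bullet\}$. A relation from $A$ to $B$ is written $R\colon A\dashrightarrow B$, and $R\colon a\dashrightarrow b$ means that $a$ is $R$-related to $b$. Relations $\{\bullet\}\dashrightarrow F$ and $F\dashrightarrow\{\bullet\}$ are identified with subsets of $F$. A monoid in $\mathbf{Rel}$ is a triple $(F;\mu,\eta)$ with relations $\mu\colon F\times F\dashrightarrow F$, $\eta\colon\{\bullet\}\dashrightarrow F$ such that $\mu\circ(\mu\times\mathrm{id})=\mu\circ(\mathrm{id}\times\mu)$ and $\mu\circ(\eta\times\mathrm{id})=\mathrm{id}=\mu\circ(\mathrm{id}\times\eta)$. A comonoid $(F;\delta,\epsilon)$ has $\delta\colon F\dashrightarrow F\times F$, $\epsilon\colon F\dashrightarrow\{\bullet\}$ with $(\delta\times\mathrm{id})\circ\delta=(\mathrm{id}\times\delta)\circ\delta$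 and $(\epsilon\times\mathrm{id})\circ\delta=\mathrm{id}=(\mathrm{id}\times\epsilon)\circ\delta$. A Frobenius algebra in $\mathbf{Rel}$ is $\mathcal{F}=(F;\mu,\eta,\delta,\epsilon)$ with $(F;\mu,\eta)$ a monoid, $(F;\delta,\epsilon)$ a comonoid, and $(\mu\times\mathrm{id})\circ(\mathrm{id}\times\delta)=\delta\circ\mu=(\mathrm{id}\times\mu)\circ(\delta\times\mathrm{id})$. A homomorphism of monoids $(F_1;\mu_1,\eta_1)\to(F_2;\mu_2,\eta_2)$ is a mapping $h\colon F_1\to F_2$ such that $a\in\eta_1$ implies $h(a)\in\eta_2$, and $\mu_1\colon(a,b)\dashrightarrow c$ implies $\mu_2\colon(h(a),h(b))\dashrightarrow h(c)$. **$\epsilon$-simplicial sets.** $\Delta$ is the category of finite chains $[n]=\{0<\dots<n\}$ and non-decreasing maps. $\Delta_\epsilon$ is the category obtained from $\Delta$ by freely adding one object $[\epsilon]$, one arrow $w\colon[1]\to[\epsilon]$, and the induced compositions. An $\epsilon$-simplicial set is a presheaf of sets on $\Delta_\epsilon$; equivalently, a simplicial set $X$ together with a set $X_\epsilon$ and a map $X_\epsilon\to X_1$ (edges in its image are ''marked''). For $n\ge1$, $\Delta_\epsilon^n$ is the $\epsilon$-simplicial set with underlying simplicial set the standard simplex $\Delta^n$ and $(\Delta_\epsilon^n)_\epsilon$ a one-element set mapped to the edge from $0$ to $n$. $\partial_i\Delta_\epsilon^n\subset\Delta_\epsilon^n$ is the codimension-one face opposite the vertex $i$, where the marked edge remains marked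 if it belongs to the face. $\Lambda^n_{\epsilon,i}=\bigcup_{j\neq i}\partial_j\Delta_\epsilon^n$. **Nerve.** The chain $[n]$ is viewed as a monoid in $\mathbf{Rel}$ (from the corresponding small category): elements are pairs $(i,j)$ with $0\le i\le j\le n$, units are the pairs $(i,i)$, and $\mu\colon((j,k),(i,j))\dashrightarrow(i,k)$ are the only related elements. For a Frobenius algebra $\mathcal{F}=(F;\mu,\eta,\delta,\epsilon)$, $N(\mathcal{F})$ is the $\epsilon$-simplicial set whose $n$-simplices are the monoid homomorphisms $[n]\to(F;\mu,\eta)$ (so $N(\mathcal{F})_1$ is identified with $F$, and $2$-simplices are triples $(a,b,c)$ with $\mu\colon(a,b)\dashrightarrow c$, where $a$ is the edge $12$, $b$ the edge $01$, $c$ the edge $02$), with $N(\mathcal{F})_\epsilon=\epsilon\subseteq F$ and the map $N(\mathcal{F})_\epsilon\to N(\mathcal{F})_1=F$ the inclusion. *)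

(* Defs.v *)
From HB Require Import structures.
From mathcomp Require Import all_boot all_order.
From mathcomp Require Import boolp.
Set Implicit Arguments.
Unset Strict Implicit.
Unset Printing Implicit Defensive.
Import Order.TTheory.
Local Obligation Tactic := idtac.

Definition rel2 (A B : Type) := A -> B -> Prop.

Definition rel_eq A B (R S : rel2 A B) := forall a b, R a b <-> S a b.
Notation "R =r S" := (rel_eq R S) (at level 70).

Definition rel_id A : rel2 A A := fun a b => a = b.
Definition rel_comp A B C (S : rel2 B C) (R : rel2 A B) : rel2 A C :=
  fun a c => exists2 b, R a b & S b c.
Notation "S \oR R" := (rel_comp S R) (at level 40, left associativity).
Definition rel_conv A B (R : rel2 A B) : rel2 B A := fun b a => R a b.
Definition rel_prod A B C D (R : rel2 A C) (S : rel2 B D) :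
  rel2 (A * B) (C * D) := fun x y => R x.1 y.1 /\ S x.2 y.2.
Notation "R \xR S" := (rel_prod R S) (at level 35, right associativity).

(* The coherence isomorphisms of (Rel, *, unit); on paper these are implicit. *)
Definition rel_assoc A B C : rel2 ((A * B) * C) (A * (B * C)) :=
  fun x y => y = (x.1.1, (x.1.2, x.2)).
Definition rel_unitl A : rel2 (unit * A) A := fun x y => y = x.2.
Definition rel_unitr A : rel2 (A * unit) A := fun x y => y = x.1.

Record is_monoid (F : Type) (mu : rel2 (F * F) F) (eta : rel2 unit F) : Prop :=
  IsMonoid {
    mon_assoc : mu \oR (mu \xR @rel_id F)
                =r mu \oR (@rel_id F \xR mu) \oR @rel_assoc F F F;
    mon_unitl : mu \oR (eta \xR @rel_id F) =r @rel_unitl F;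
    mon_unitr : mu \oR (@rel_id F \xR eta) =r @rel_unitr F }.

Record is_comonoid (F : Type) (delta : rel2 F (F * F)) (eps : rel2 F unit) :
  Prop := IsComonoid {
    comon_assoc : @rel_assoc F F F \oR (delta \xR @rel_id F) \oR delta
                  =r (@rel_id F \xR delta) \oR delta;
    comon_unitl : (eps \xR @rel_id F) \oR delta =r rel_conv (@rel_unitl F);
    comon_unitr : (@rel_id F \xR eps) \oR delta =r rel_conv (@rel_unitr F) }.

Record relMonoid := RelMonoid {
  mon_sort :> Type;
  mmu : rel2 (mon_sort * mon_sort) mon_sort;
  meta : rel2 unit mon_sort;
  monP : is_monoid mmu meta }.

Record relFrobenius := RelFrobenius {
  frob_sort : Type;
  fmu : rel2 (frob_sort * frob_sort) frob_sort;
  feta : rel2 unit frob_sort;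
  fdelta : rel2 frob_sort (frob_sort * frob_sort);
  feps : rel2 frob_sort unit;
  frob_monoid : is_monoid fmu feta;
  frob_comonoid : is_comonoid fdelta feps;
  frob_l : (fmu \xR @rel_id frob_sort)
             \oR rel_conv (@rel_assoc frob_sort frob_sort frob_sort)
             \oR (@rel_id frob_sort \xR fdelta)
           =r fdelta \oR fmu;
  frob_r : (@rel_id frob_sort \xR fmu)
             \oR @rel_assoc frob_sort frob_sort frob_sort
             \oR (fdelta \xR @rel_id frob_sort)
           =r fdelta \oR fmu }.

Definition frob_relMonoid (F : relFrobenius) : relMonoid :=
  RelMonoid (frob_monoid F).

Record monHom (M N : relMonoid) := MonHom {
  hom_fun :> M -> N;
  hom_unit : forall a, meta tt a -> meta tt (hom_fun a);
  hom_mul : forall a b c, mmu (a, b) c ->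
              mmu (hom_fun a, hom_fun b) (hom_fun c) }.

Lemma monHom_eq (M N : relMonoid) (h k : monHom M N) : h =1 k -> h = k.
Proof.
case: h k => [h hu hm] [k ku km] /= /funext hk; subst k.
by rewrite (Prop_irrelevance hu ku) (Prop_irrelevance hm km).
Qed.

Program Definition monHom_comp (L M N : relMonoid) (g : monHom M N)
  (f : monHom L M) : monHom L N := @MonHom L N (g \o f) _ _.
Next Obligation. by move=> L M N g f a /(hom_unit f) /(hom_unit g). Qed.
Next Obligation. by move=> L M N g f a b c /(hom_mul f) /(hom_mul g). Qed.

Record category := Category {
  ob :> Type;
  hom : ob -> ob -> Type;
  idm : forall a, hom a a;
  compm : forall a b c, hom b c -> hom a b -> hom a c;
  compm1 : forall a b (f : hom a b), compm f (idm a) = f;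
  comp1m : forall a b (f : hom a b), compm (idm b) f = f;
  compmA : forall a b c d (h : hom c d) (g : hom b c) (f : hom a b),
    compm h (compm g f) = compm (compm h g) f }.

Record presheaf (C : category) := Presheaf {
  psh :> C -> Type;
  res : forall a b, hom a b -> psh b -> psh a;
  res1 : forall a (x : psh a), res (idm a) x = x;
  resM : forall a b c (g : hom b c) (f : hom a b) (x : psh c),
    res (compm g f) x = res f (res g x) }.

Record pshMor (C : category) (X Y : presheaf C) := PshMor {
  mor_fun :> forall a, X a -> Y a;
  mor_nat : forall a b (f : hom a b) (x : X b),
    mor_fun (res f x) = res f (mor_fun x) }.

Lemma pshMor_eq (C : category) (X Y : presheaf C) (g h : pshMor X Y) :
  (forall a (x : X a), g a x = h a x) -> g = h.
Proof.
case: g h => [g gn] [h hn] /= gh.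
have E : g = h by apply: functional_extensionality_dep => a; apply/funext.
by subst h; rewrite (Prop_irrelevance gn hn).
Qed.

Program Definition pshMor_comp (C : category) (X Y Z : presheaf C)
  (g : pshMor Y Z) (f : pshMor X Y) : pshMor X Z :=
  @PshMor C X Z (fun a x => g a (f a x)) _.
Next Obligation. by move=> C X Y Z g f a b u x /=; rewrite !mor_nat. Qed.

Record subpresheaf (C : category) (X : presheaf C) := Subpresheaf {
  smem : forall a, X a -> Prop;
  smem_res : forall a b (f : hom a b) (x : X b), smem x -> smem (res f x) }.

Program Definition sub_psh (C : category) (X : presheaf C)
    (A : subpresheaf X) : presheaf C :=
  @Presheaf C (fun a => {x : X a | smem A x})
    (fun a b f x => exist _ (res f (sval x)) (smem_res f (svalP x))) _ _.
Next Obligation. by move=> C X A a [x hx]; apply: eq_exist; exact: res1. Qed.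
Next Obligation.
by move=> C X A a b c g f [x hx]; apply: eq_exist; exact: resM.
Qed.

Program Definition sub_incl (C : category) (X : presheaf C)
    (A : subpresheaf X) : pshMor (sub_psh A) X :=
  @PshMor C (sub_psh A) X (fun a x => sval x) _.
Next Obligation. by []. Qed.

Definition unique_extension (C : category) (X : presheaf C)
    (A : subpresheaf X) (Y : presheaf C) :=
  forall f : pshMor (sub_psh A) Y,
    exists! g : pshMor X Y, pshMor_comp g (sub_incl A) = f.

Notation chain n := 'I_n.+1.
Notation mono m n := {omorphism chain m -> chain n}.

Lemma mono_eq m n (f g : mono m n) : f =1 g -> f = g.
Proof.
case: f g => [f [[hf]]] [g [[hg]]] /= /funext fg; subst g.
by rewrite (Prop_irrelevance hf hg).
Qed.

Inductive deltaE_ob := Chain of nat | Eps.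

(* [w] is freely added, so the arrows [m] -> [eps] are the formal composites
   w \o f with f : [m] -> [1], represented by f, and [eps] has no arrow to
   any [n]. *)
Definition deltaE_hom (a b : deltaE_ob) : Type :=
  match a, b with
  | Chain m, Chain n => mono m n
  | Chain m, Eps => mono m 1
  | Eps, Chain _ => void
  | Eps, Eps => unit
  end.

Definition mono_id m : mono m m := idfun.
Definition mono_comp l m n (g : mono m n) (f : mono l m) : mono l n := g \o f.

Definition deltaE_id (a : deltaE_ob) : deltaE_hom a a :=
  match a with Chain m => mono_id m | Eps => tt end.

Definition deltaE_comp (a b c : deltaE_ob) :
    deltaE_hom b c -> deltaE_hom a b -> deltaE_hom a c :=
  match a, b, c with
  | Chain _, Chain _, Chain _ => fun g f => mono_comp g f
  | Chain _, Chain _, Eps => fun g f => mono_comp g f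
  | Chain _, Eps, Eps => fun _ f => f
  | Eps, Eps, Eps => fun _ _ => tt
  | _, Eps, Chain _ => fun g _ => match g with end
  | Eps, Chain _, _ => fun _ f => match f with end
  end.

Program Definition deltaE : category :=
  @Category deltaE_ob deltaE_hom deltaE_id deltaE_comp _ _ _.
Next Obligation. by move=> [m|] [n|] //= f; [apply: mono_eq..|case: f]. Qed.
Next Obligation. by move=> [m|] [n|] //= f; [apply: mono_eq|case: f]. Qed.
Next Obligation.
by move=> [k|] [l|] [m|] [n|] //= h g f; try (by case: f || case: g || case: h);
  apply: mono_eq.
Qed.

Definition long_edge_fun n (i : chain 1) : chain n :=
  if i == ord0 then ord0 else ord_max.
Lemma long_edge_mono n : {homo @long_edge_fun n : i j / (i <= j)%O}.
Proof.
move=> i j; rewrite !leEord /long_edge_fun -!val_eqE /=.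
case: eqP => // i0; case: eqP => [j0|_]; last by rewrite leqnn.
by rewrite j0 leqn0 => /eqP.
Qed.
HB.instance Definition _ n :=
  Order.isOrderMorphism.Build _ (chain 1) _ (chain n) (@long_edge_fun n)
    (@long_edge_mono n).
Definition long_edge n : mono 1 n := @long_edge_fun n.

Definition simplexE_ob (n : nat) (a : deltaE) : Type :=
  match a with Chain m => mono m n | Eps => unit end.

Definition simplexE_res n (a b : deltaE) :
    hom a b -> simplexE_ob n b -> simplexE_ob n a :=
  match a, b with
  | Chain _, Chain _ => fun f x => mono_comp x f
  | Chain _, Eps => fun f _ => mono_comp (long_edge n) f
  | Eps, Chain _ => fun f _ => match f with end
  | Eps, Eps => fun _ x => x
  end.

Program Definition simplexE (n : nat) : presheaf deltaE :=
  @Presheaf deltaE (simplexE_ob n) (@simplexE_res n) _ _.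
Next Obligation. by move=> n [m|] //= x; apply: mono_eq. Qed.
Next Obligation.
by move=> n [k|] [l|] [m|] //= g f x; try (by case: f || case: g);
  apply: mono_eq.
Qed.

(* The marked edge lies in a face iff its underlying edge 0 -> n does. *)
Definition face_mem n (j : chain n) (a : deltaE) : simplexE n a -> Prop :=
  match a with
  | Chain m => fun x : mono m n => forall k : chain m, x k <> j
  | Eps => fun _ => forall k : chain 1, long_edge n k <> j
  end.

Program Definition faceE n (j : chain n) : subpresheaf (simplexE n) :=
  @Subpresheaf deltaE (simplexE n) (@face_mem n j) _.
Next Obligation.
by move=> n j [l|] [m|] //= f x hx; first [by case: f | move=> k; apply: hx].
Qed.

Program Definition hornE n (i : chain n) : subpresheaf (simplexE n) :=
  @Subpresheaf deltaE (simplexE n)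
    (fun a x => exists2 j : chain n, j <> i & smem (faceE j) x) _.
Next Obligation.
by move=> n i a b f x [j ji hj]; exists j => //; exact: (smem_res f hj).
Qed.

(* [n] as a monoid in Rel: (i, j) is the arrow i -> j of the chain, and the
   composite of (j, k) after (i, j) is (i, k). *)
Definition arrow n := {p : chain n * chain n | p.1 <= p.2}.
Definition arrow_mu n : rel2 (arrow n * arrow n) (arrow n) := fun x z =>
  [/\ (sval x.1).1 = (sval x.2).2, (sval z).1 = (sval x.2).1
    & (sval z).2 = (sval x.1).2].
Definition arrow_eta n : rel2 unit (arrow n) := fun _ x => (sval x).1 = (sval x).2.

Lemma arrow_eq n (x y : arrow n) :
  (sval x).1 = (sval y).1 -> (sval x).2 = (sval y).2 -> x = y.
Proof.
case: x y => [[i j] ij] [[k l] kl] /= ik jl; subst k l.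
by rewrite (bool_irrelevance ij kl).
Qed.

Lemma arrow_monP n : is_monoid (@arrow_mu n) (@arrow_eta n).
Proof.
split.
- move=> [[x y] z] t; split.
  + move=> [[u z'] /= [[/= xy uy ux] /= ezz] [/= uz tz tu]].
    red in ezz; subst z'.
    have yz : (sval z).1 <= (sval y).2.
      by apply: leq_trans (svalP z) _; rewrite -uz uy (svalP y).
    exists (x, (y, z)) => //.
    exists (x, exist (fun p : chain n * chain n => p.1 <= p.2)
                 ((sval z).1, (sval y).2) yz).
      by split => //; split => //=; rewrite -uz uy.
    by split => //=; rewrite -?ux.
  + move=> [_ -> [[x' u] [/= exx [/= yz uz uy]] [/= xu tu tx]]].
    red in exx; subst x'.
    have yx : (sval y).1 <= (sval x).2.
      by apply: leq_trans (svalP y) _; rewrite -uy -xu (svalP x).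
    exists (exist (fun p : chain n * chain n => p.1 <= p.2)
                 ((sval y).1, (sval x).2) yx, z).
      by split => //; split => //=; rewrite xu uy.
    by split => //=; rewrite tu uz.
- move=> [[] y] t; split.
  + move=> [[e y'] /= [/= ee ey] [/= ey2 ty te]].
    red in ee, ey; subst y'.
    by apply: arrow_eq => //=; rewrite te -ee ey2.
  + move=> /= ->.
    exists (exist (fun p : chain n * chain n => p.1 <= p.2)
                 ((sval y).2, (sval y).2) (leqnn _), y) => //.
- move=> [x []] t; split.
  + move=> [[x' e] /= [/= ex ee] [/= xe te tx]].
    red in ee, ex; subst x'.
    by apply: arrow_eq => //=; rewrite te ee xe.
  + move=> /= ->.
    exists (x, exist (fun p : chain n * chain n => p.1 <= p.2)
                 ((sval x).1, (sval x).1) (leqnn _)) => //.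
Qed.

Definition chain_mon n : relMonoid := RelMonoid (@arrow_monP n).

Definition chain_map_fun m n (f : mono m n) (x : arrow m) : arrow n :=
  exist _ (f (sval x).1, f (sval x).2) (omorph_le f (svalP x)).

Program Definition chain_map m n (f : mono m n) :
  monHom (chain_mon m) (chain_mon n) :=
  @MonHom (chain_mon m) (chain_mon n) (chain_map_fun f) _ _.
Next Obligation. by move=> m n f x hx; rewrite /= /arrow_eta /= hx. Qed.
Next Obligation.
by move=> m n f x y z [/= xy zy zx]; split; rewrite /= ?xy ?zy ?zx.
Qed.

Definition arrow01 : chain_mon 1 :=
  exist _ (ord0, ord_max) isT.

Lemma chain1P (i : chain 1) : i = ord0 \/ i = ord_max.
Proof.
by case: i => [[|[|//]]] li; [left|right]; apply: val_inj.
Qed.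

Section Edges.
Variable M : relMonoid.
Implicit Types x y u v : M.

Lemma mul_unitl u x y : meta tt u -> mmu (u, x) y -> y = x.
Proof.
by move=> hu hm; apply/(mon_unitl (monP M) (tt, x) y); exists (u, x).
Qed.

Lemma mul_unitr u x y : meta tt u -> mmu (x, u) y -> y = x.
Proof.
by move=> hu hm; apply/(mon_unitr (monP M) (x, tt) y); exists (x, u).
Qed.

Lemma target_exists x : exists2 u, meta tt u & mmu (u, x) x.
Proof.
have [_ /(_ erefl)] := mon_unitl (monP M) (tt, x) x.
by move=> [[u y] [/= hu hx]] hm; red in hx; subst y; exists u.
Qed.

Lemma source_exists x : exists2 u, meta tt u & mmu (x, u) x.
Proof.
have [_ /(_ erefl)] := mon_unitr (monP M) (x, tt) x.
by move=> [[y u] [/= hx hu]] hm; red in hx; subst y; exists u.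
Qed.

Lemma unit_idem u : meta tt u -> mmu (u, u) u.
Proof.
move=> hu; have [v _ hm] := target_exists u.
have e := mul_unitr hu hm; by rewrite -e in hm.
Qed.

Lemma target_unique x u v :
  meta tt u -> mmu (u, x) x -> meta tt v -> mmu (v, x) x -> u = v.
Proof.
move=> hu ux hv vx.
have [_ h] := mon_assoc (monP M) ((u, v), x) x.
case: h; first by exists (u, (v, x)) => //; exists (u, x).
move=> [z x'] [/= hz _] _.
by rewrite -(mul_unitl hu hz) -(mul_unitr hv hz).
Qed.

Lemma source_unique x u v :
  meta tt u -> mmu (x, u) x -> meta tt v -> mmu (x, v) x -> u = v.
Proof.
move=> hu xu hv xv.
have [h _] := mon_assoc (monP M) ((x, u), v) x.
case: h; first by exists (x, v).
move=> _ -> [[x' z] [/= _ hz]] _.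
by rewrite -(mul_unitl hu hz) -(mul_unitr hv hz).
Qed.

(* h |-> h(0,1) identifies the 1-simplices of the nerve with elements of M. *)
Lemma edge_unique x : exists! h : monHom (chain_mon 1) M, h arrow01 = x.
Proof.
have [u hu xu] := source_exists x; have [v hv vx] := target_exists x.
pose e (p : arrow 1) : M :=
  if (sval p).1 != (sval p).2 then x else if (sval p).1 == ord0 then u else v.
have e_unit (p : arrow 1) : arrow_eta tt p -> meta tt (e p).
  by rewrite /arrow_eta /e => ->; rewrite eqxx /=; case: ifP.
have e_mul a b c : arrow_mu (a, b) c -> mmu (e a, e b) (e c).
  case: a b c => [[j k] /= jk] [[i j'] /= ij] [[i' k'] /= ik].
  move=> [/= jj ii kk]; subst j' i' k'; rewrite /e /=.
  case: (chain1P i) (chain1P j) (chain1P k) ij jk {ik}.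
    by move=> -> [->|->] [->|->] //= _ _; apply: unit_idem.
  by move=> -> [->|->] // [->|->] //= _ _; apply: unit_idem.
exists (@MonHom (chain_mon 1) M e e_unit e_mul); split => // h hx.
apply: monHom_eq => -[[i j] /= ij]; rewrite /= /e /=.
case: (chain1P i) (chain1P j) ij => -> [->|->] // ij.
- apply: (source_unique hu xu); first exact: hom_unit.
  by rewrite -[x]hx; apply: hom_mul.
- by rewrite -hx; congr (h _); apply: arrow_eq.
- apply: (target_unique hv vx); first exact: hom_unit.
  by rewrite -[x]hx; apply: hom_mul.
Qed.

End Edges.

Definition edge_hom (M : relMonoid) (x : M) : monHom (chain_mon 1) M :=
  sval (cid (edge_unique x)).

Lemma edge_homE (M : relMonoid) (x : M) : edge_hom x arrow01 = x.
Proof. by rewrite /edge_hom; case: cid => h []. Qed.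

Definition nerve_ob (F : relFrobenius) (a : deltaE) : Type :=
  match a with
  | Chain n => monHom (chain_mon n) (frob_relMonoid F)
  | Eps => {x : frob_sort F | feps x tt}
  end.

Definition nerve_res (F : relFrobenius) (a b : deltaE) :
    hom a b -> nerve_ob F b -> nerve_ob F a :=
  match a, b with
  | Chain _, Chain _ => fun f h => monHom_comp h (chain_map f)
  | Chain _, Eps => fun f x =>
      monHom_comp (@edge_hom (frob_relMonoid F) (sval x)) (chain_map f)
  | Eps, Chain _ => fun f _ => match f with end
  | Eps, Eps => fun _ x => x
  end.

Program Definition nerve (F : relFrobenius) : presheaf deltaE :=
  @Presheaf deltaE (nerve_ob F) (@nerve_res F) _ _.
Next Obligation.
move=> F [m|] //= h; apply: monHom_eq => x /=.
by congr (h _); apply: arrow_eq.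
Qed.
Next Obligation.
move=> F [k|] [l|] [m|] //= g f x; try (by case: f || case: g);
  by apply: monHom_eq => y /=; congr (_ _); apply: arrow_eq.
Qed.

(* Main.v *)
(* The relation "mu(a, b) meets epsilon" is the graph of a bijection of F: by
   the Frobenius law it is a self-duality of F in Rel, with copairing
   "delta(u) contains (a, b) for some unit u". Hence every unit is the source,
   and the target, of exactly one element of epsilon, which fills horns of
   dimension 1, and two edges of a triangle whose long edge is marked determine
   the third, which fills those of dimension 2. In dimension 3 the missing
   triangle commutes by associativity and uniqueness in that bijection, and from
   dimension 4 on the horn contains all triangles. *)
Require Import Defs.
From mathcomp Require Import all_boot.
From HB Require Import structures.
From mathcomp Require Import all_order boolp.
Set Implicit Arguments.
Unset Strict Implicit.
Unset Printing Implicit Defensive.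
Import Order.TTheory.

Definition ends n (p : arrow n) : nat * nat :=
  ((sval p).1 : nat, (sval p).2 : nat).

(** * Edges and triangles in a monoid *)

Section MonoidFacts.
Variable M : relMonoid.
Implicit Types x y z t u : M.

Lemma mul_assocl x y z s t :
  mmu (y, z) s -> mmu (x, s) t -> exists2 r, mmu (x, y) r & mmu (r, z) t.
Proof.
move=> yz xs; have [_ h] := mon_assoc (monP M) ((x, y), z) t.
case: h; first by exists (x, (y, z)) => //; exists (x, s).
by move=> [r z'] [/= xy e] rz; red in e; subst z'; exists r.
Qed.

Lemma mul_assocr x y z r t :
  mmu (x, y) r -> mmu (r, z) t -> exists2 s, mmu (y, z) s & mmu (x, s) t.
Proof.
move=> xy rz; have [h _] := mon_assoc (monP M) ((x, y), z) t.
case: h; first by exists (r, z).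
by move=> _ -> [[x' s] [/= e yz]] xs; red in e; subst x'; exists s.
Qed.

(** Reassociating [x (y u)] gives some [r] in the product of [x] and [y] with [z] in [r u], and the
    unit law forces [r = z]. *)
Lemma source_mul x y z u : meta tt u -> mmu (y, u) y -> mmu (x, y) z ->
  mmu (z, u) z.
Proof.
move=> hu yu xy; have [r _ ru] := mul_assocl yu xy.
by rewrite {1}(mul_unitr hu ru).
Qed.

Lemma target_mul x y z u : meta tt u -> mmu (u, x) x -> mmu (x, y) z ->
  mmu (u, z) z.
Proof.
move=> hu ux xy; have [s _ us] := mul_assocr ux xy.
by rewrite {1}(mul_unitl hu us).
Qed.

(** Writing [y] as [u y] and reassociating shows that [x u] is defined, and a defined product with a
    unit returns the other factor. *)
Lemma source_target x y z u : meta tt u -> mmu (u, y) y -> mmu (x, y) z ->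
  mmu (x, u) x.
Proof.
move=> hu uy xy; have [r xu _] := mul_assocl uy xy.
by rewrite -{2}(mul_unitr hu xu).
Qed.

(** The only values left to choose are those at the vertices: the source of [y], the unit where [x]
    and [y] meet, and the target of [x]. All relations except the given one are then unit laws. *)
Lemma triangle_hom x y z : mmu (x, y) z ->
  exists h : monHom (chain_mon 2) M, forall p : arrow 2,
    [/\ ends p = (0, 1) -> h p = y,
        ends p = (1, 2) -> h p = x
      & ends p = (0, 2) -> h p = z].
Proof.
move=> xy.
have [u0 hu0 yu0] := source_exists y; have [u1 hu1 u1y] := target_exists y.
have [u2 hu2 u2x] := target_exists x.
have xu1 := source_target hu1 u1y xy.
have zu0 := source_mul hu0 yu0 xy; have u2z := target_mul hu2 u2x xy.
(* As [p] is non-decreasing, the wildcard branches stand for [(0, 2)], [(1, 2)] and [(2, 2)]. *)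
pose e (p : arrow 2) : M :=
  match (sval p).1 : nat, (sval p).2 : nat with
  | 0, 0 => u0 | 0, 1 => y | 0, _ => z | 1, 1 => u1 | 1, _ => x | _, _ => u2
  end.
have e_unit p : arrow_eta tt p -> meta tt (e p).
  by rewrite /arrow_eta /e => ->; case: (sval p).2 => -[|[|[|]]].
have e_mul a b c : arrow_mu (a, b) c -> mmu (e a, e b) (e c).
  case: a b c => [[j k] /= jk] [[i j'] /= ij] [[i' k'] /= ik].
  move=> [/= jj ii kk]; subst j' i' k'; rewrite /e /= {ik}.
  case: i j k ij jk => [[|[|[|i]]] hi] [[|[|[|j]]] hj] [[|[|[|k]]] hk] //= _ _;
    exact: unit_idem.
exists (@MonHom (chain_mon 2) M e e_unit e_mul) => p.
by split; rewrite /ends /= /e; case=> -> ->.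
Qed.

End MonoidFacts.

(** * The pairing of a Frobenius algebra *)

Section Pairing.
Variable F : relFrobenius.
Local Notation T := (frob_sort F).
Local Notation M := (frob_relMonoid F).
Implicit Types a b c e : T.

(** This is the composite of mu and epsilon, and [copaired] that of eta and delta; the next two
    lemmas are halves of the zigzag laws between them. *)
Definition paired a b := exists2 e, fmu (a, b) e & feps e tt.

Definition copaired a b := exists2 u, @feta F tt u & fdelta u (a, b).

(** The Frobenius law turns the two hypotheses into [(e, c)] lying in delta of [a u = a], with [e]
    in the counit; the counit law then gives [c = a]. *)
Lemma paired_copaired a b c : paired a b -> copaired b c -> c = a.
Proof.
move=> [e abe he] [u hu ubc].
have [h _] := @frob_l F (a, u) (e, c).
case: h.
  by exists (a, (b, c)) => //; exists ((a, b), c).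
move=> a' aua' a'ec.
have e' : a' = a := @mul_unitr M u a a' hu aua'; subst a'.
symmetry; apply/(comon_unitl (frob_comonoid F) a (tt, c)).
by exists (e, c).
Qed.

Lemma copaired_paired a b c : copaired a b -> paired b c -> a = c.
Proof.
move=> [u hu uab] [e bce he].
have [h _] := @frob_r F (u, c) (a, e).
case: h.
  by exists ((a, b), c) => //; exists (a, (b, c)).
move=> c' ucc' c'ae.
have e' : c' = c := @mul_unitl M u c c' hu ucc'; subst c'.
symmetry; apply/(comon_unitr (frob_comonoid F) c (a, tt)).
by exists (a, e).
Qed.

(** The Frobenius law read backwards: [(e, a)] lies in delta of [a = a u] for some [e] in the
    counit, and splitting through delta of [u] produces [b]. *)
Lemma paired_existsr a : exists b, paired a b.
Proof.
have [_ /(_ erefl) [[e a'] aea' [/= he e']]] :=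
  comon_unitl (frob_comonoid F) a (tt, a).
red in e'; subst a'.
have [u hu au] := @source_exists M a.
have [_ h] := @frob_l F (a, u) (e, a).
case: h; first by exists a.
move=> [a3 [b' a4]] [/= e1 ubd] [[[a1 b] a2] e2 [/= abe e3]].
red in e1, e2, e3; case: e2 => ? ? ?; subst a3 b' a4 a1 a2.
by exists b, e.
Qed.

(** Mirror image of the previous argument. The element found is also copaired with [b], which is
    what the uniqueness proofs feed into the zigzag laws. *)
Lemma paired_existsl b : exists2 a, paired a b & copaired b a.
Proof.
have [_ /(_ erefl) [[b' e] beb' [/= e' he]]] :=
  comon_unitr (frob_comonoid F) b (b, tt).
red in e'; subst b'.
have [u hu ub] := @target_exists M b.
have [_ h] := @frob_r F (u, b) (b, e).
case: h; first by exists b.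
move=> [[b3 a'] b4] [/= ubd e1] [[b1 [a b2]] e2 [/= e3 abe]].
red in e1, e2, e3; case: e2 => ? ? ?; subst b1 a b2 b3 b4.
by exists a'; [exists e | exists u].
Qed.

Lemma paired_uniquer a b b' : paired a b -> paired a b' -> b = b'.
Proof.
move=> ab ab'; have [c cb bc] := paired_existsl b.
have ca := paired_copaired ab bc; subst c.
exact: copaired_paired bc ab'.
Qed.

Lemma paired_uniquel a a' b : paired a b -> paired a' b -> a = a'.
Proof.
move=> ab a'b; have [c _ bc] := paired_existsl b.
by rewrite -(paired_copaired ab bc) (paired_copaired a'b bc).
Qed.

(** The partner of the unit [u] is itself the product, hence lies in the counit. *)
Lemma counit_with_source u : @feta F tt u ->
  exists2 e, feps e tt & fmu (e, u) e.
Proof.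
move=> hu; have [a [e au he] _] := paired_existsl u.
have ea : e = a := @mul_unitr M u a e hu au.
by subst e; exists a.
Qed.

Lemma counit_with_target u : @feta F tt u ->
  exists2 e, feps e tt & fmu (u, e) e.
Proof.
move=> hu; have [b [e ub he]] := paired_existsr u.
have eb : e = b := @mul_unitl M u b e hu ub.
by subst e; exists b.
Qed.

Lemma counit_source_inj u e e' : feps e tt -> fmu (e, u) e ->
  feps e' tt -> fmu (e', u) e' -> e = e'.
Proof.
by move=> he eu he' eu'; apply: (@paired_uniquel e e' u); [exists e|exists e'].
Qed.

Lemma counit_target_inj u e e' : feps e tt -> fmu (u, e) e ->
  feps e' tt -> fmu (u, e') e' -> e = e'.
Proof.
by move=> he eu he' eu'; apply: (@paired_uniquer u e e'); [exists e|exists e'].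
Qed.

(** The partner [a] of [b] has a product with [b] in the counit and with source [u]; [c] is the only
    such element. *)
Lemma left_division b c u : @feta F tt u -> fmu (b, u) b -> fmu (c, u) c ->
  feps c tt -> exists a, fmu (a, b) c.
Proof.
move=> hu bu cu hc; have [a [c' abc' hc'] _] := paired_existsl b.
have c'u : fmu (c', u) c' := @source_mul M a b c' u hu bu abc'.
by rewrite (counit_source_inj hc cu hc' c'u); exists a.
Qed.

Lemma right_division a c u : @feta F tt u -> fmu (u, a) a -> fmu (u, c) c ->
  feps c tt -> exists b, fmu (a, b) c.
Proof.
move=> hu ua uc hc; have [b [c' abc' hc']] := paired_existsr a.
have uc' : fmu (u, c') c' := @target_mul M a b c' u hu ua abc'.
by rewrite (counit_target_inj hc uc hc' uc'); exists b.
Qed.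

End Pairing.

(** * Morphisms into the nerve *)

Section Simplices.

Definition mk_mono m n (f : chain m -> chain n)
    (hf : {homo f : x y / (x <= y)%O}) : mono m n :=
  HB.pack f (Order.isOrderMorphism.Build _ (chain m) _ (chain n) f hf).

(** The default value of [nth] serves as the last vertex, here and for edges. *)
Lemma triangle_homo n (a b c : chain n) : a <= b -> b <= c ->
  {homo (fun k : chain 2 => nth c [:: a; b] k) : x y / (x <= y)%O}.
Proof.
move=> ab bc [[|[|[|x]]] hx] [[|[|[|y]]] hy] //= _; rewrite leEord //.
exact: leq_trans ab bc.
Qed.

Definition triangle n (a b c : chain n) (ab : a <= b) (bc : b <= c) :
    mono 2 n :=
  mk_mono (triangle_homo ab bc).

Lemma edge_homo n (p : arrow n) :
  {homo (fun k : chain 1 => nth (sval p).2 [:: (sval p).1] k)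
    : x y / (x <= y)%O}.
Proof.
by case: p => p hp [[|[|x]] hx] [[|[|y]] hy] //= _; rewrite leEord.
Qed.

Definition edge n (p : arrow n) : mono 1 n := mk_mono (@edge_homo n p).

Lemma chain_map_edge n (p : arrow n) : chain_map_fun (edge p) arrow01 = p.
Proof. exact: arrow_eq. Qed.

Definition long_arrow n : arrow n := chain_map_fun (long_edge n) arrow01.

End Simplices.

Lemma sval_inj T (P : T -> Prop) : injective (@sval T P).
Proof. by move=> [x hx] [y hy] /=; exact: eq_exist. Qed.

Section Extension.
Variables (F : relFrobenius) (n : nat).
Local Notation M := (frob_relMonoid F).

Lemma edge_hom_ext (h k : monHom (chain_mon 1) M) :
  h arrow01 = k arrow01 -> h = k.
Proof.
move=> hk; have [g [_ gu]] := edge_unique (k arrow01).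
by rewrite -(gu h hk) -(gu k).
Qed.

Definition yoneda_fun (h : monHom (chain_mon n) M)
    (hh : feps (h (long_arrow n)) tt) (a : deltaE) :
    simplexE n a -> nerve F a :=
  match a return simplexE n a -> nerve F a with
  | Chain m => fun x => monHom_comp h (chain_map x)
  | Eps => fun _ => exist _ (h (long_arrow n)) hh
  end.

Lemma yoneda_nat h hh (a b : deltaE) (f : hom a b) (x : simplexE n b) :
  @yoneda_fun h hh a (res f x) = res f (@yoneda_fun h hh b x).
Proof.
case: a b f x => [l|] [m|] //= f x; try by case: f.
  by apply: monHom_eq => p /=; congr (h _); apply: arrow_eq.
(* Naturality at arrows into [Eps]: the nerve restricts a marked element through [edge_hom], which
   must be recognised as [h] along the long edge. *)
have <- : monHom_comp h (chain_map (long_edge n)) =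
    edge_hom (h (long_arrow n) : M).
  by apply: edge_hom_ext; rewrite edge_homE.
by apply: monHom_eq => p /=; congr (h _); apply: arrow_eq.
Qed.

Definition yoneda h hh : pshMor (simplexE n) (nerve F) :=
  PshMor (@yoneda_nat h hh).

Variable A : subpresheaf (simplexE n).
Implicit Types f : pshMor (sub_psh A) (nerve F).

Definition sub_hom f m (x : mono m n) (hx : smem A (a := Chain m) x) :
  monHom (chain_mon m) M := f (Chain m) (exist _ x hx).

Lemma sub_hom_res f l m (e : mono l m) (x : mono m n) hx hy :
  @sub_hom f l (mono_comp x e) hy =
  monHom_comp (@sub_hom f m x hx) (chain_map e).
Proof.
pose e' : hom (Chain l : deltaE) (Chain m : deltaE) := e.
rewrite /sub_hom.
have -> : exist (smem A (a := Chain l)) (mono_comp x e) hy =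
    res (e' : hom _ _) (exist _ x hx : sub_psh A (Chain m)).
  exact: eq_exist.
exact: (mor_nat f e' (exist _ x hx)).
Qed.

Lemma sub_hom_edge f m (x : mono m n) hx (y : mono 1 n) hy (p : arrow m) :
  chain_map_fun x p = chain_map_fun y arrow01 ->
  @sub_hom f m x hx p = @sub_hom f 1 y hy arrow01.
Proof.
move=> xy; have yE : y = mono_comp x (edge p).
  apply: mono_eq => k; case: (chain1P k) => ->.
    by have /= := congr1 (fun q : arrow n => (sval q).1) xy.
  by have /= := congr1 (fun q : arrow n => (sval q).2) xy.
subst y.
by rewrite (sub_hom_res _ hx) /= chain_map_edge.
Qed.

(** Both sides restrict to the edge spanned by the common image arrow, so on simplices [f] amounts
    to a function on the arrows of the chain that lie in [A]. *)
Lemma sub_hom_eq f l m (x : mono l n) hx (y : mono m n) hy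
    (p : arrow l) (q : arrow m) :
  chain_map_fun x p = chain_map_fun y q ->
  @sub_hom f l x hx p = @sub_hom f m y hy q.
Proof.
move=> xy; have hz : smem A (a := Chain 1) (mono_comp x (edge p)).
  exact: (@smem_res _ _ A (Chain 1) (Chain l) (edge p) x hx).
have E : chain_map_fun x p = chain_map_fun (mono_comp x (edge p)) arrow01.
  exact: arrow_eq.
by rewrite (sub_hom_edge f hx hz E) (sub_hom_edge f hy hz (etrans (esym xy) E)).
Qed.

Lemma sub_eps f t (he : smem A (a := Eps) t) (x : mono 1 n) hx :
  chain_map_fun x arrow01 = long_arrow n ->
  sval (f Eps (exist _ t he)) = @sub_hom f 1 x hx arrow01.
Proof.
(* The added arrow from [[1]] to [Eps] is represented by the identity of [[1]]. *)
move=> xl; pose w : hom (Chain 1 : deltaE) (Eps : deltaE) := mono_id 1.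
have hl : smem A (a := Chain 1) (mono_comp (long_edge n) (mono_id 1)).
  exact: (@smem_res _ _ A (Chain 1) Eps w t he).
have -> : @sub_hom f 1 x hx arrow01 = sub_hom f hl arrow01.
  by apply: sub_hom_eq; rewrite xl; apply: arrow_eq.
rewrite /sub_hom.
have -> : exist (smem A (a := Chain 1)) _ hl =
    res w (exist _ t he : sub_psh A Eps).
  exact: eq_exist.
rewrite (mor_nat f w) /=.
rewrite (_ : chain_map_fun _ _ = arrow01) ?edge_homE //.
exact: arrow_eq.
Qed.

Lemma sub_eps_long f t (he : smem A (a := Eps) t) :
  exists hx : smem A (a := Chain 1) (long_edge n),
    feps (@sub_hom f 1 (long_edge n) hx arrow01) tt.
Proof.
pose w : hom (Chain 1 : deltaE) (Eps : deltaE) := mono_id 1.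
have hx : smem A (a := Chain 1) (long_edge n).
  have := @smem_res _ _ A (Chain 1) Eps w t he.
  by rewrite (_ : res w t = long_edge n) //; apply: mono_eq.
by exists hx; rewrite -(sub_eps f he hx) //; exact: (svalP (f Eps _)).
Qed.

(** Edges suffice, because a homomorphism is a function on arrows and each arrow is an edge; see
    [agrees_hom]. *)
Definition agrees f (h : monHom (chain_mon n) M) :=
  forall (x : mono 1 n) hx,
    h (chain_map_fun x arrow01) = @sub_hom f 1 x hx arrow01.

Lemma agrees_hom f h m (x : mono m n) hx (p : arrow m) : agrees f h ->
  h (chain_map_fun x p) = @sub_hom f m x hx p.
Proof.
move=> fh; have hz : smem A (a := Chain 1) (mono_comp x (edge p)).
  exact: (@smem_res _ _ A (Chain 1) (Chain m) (edge p) x hx).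
have E : chain_map_fun x p = chain_map_fun (mono_comp x (edge p)) arrow01.
  exact: arrow_eq.
by rewrite (sub_hom_edge f hx hz E) -fh E.
Qed.

(* Yoneda: a morphism out of the simplex is a homomorphism h with h(0,n) in
   the counit, and it extends f as soon as it does so on edges. *)
Lemma unique_extension_nerve :
  (forall f, exists! h : monHom (chain_mon n) M,
     feps (h (long_arrow n)) tt /\ agrees f h) ->
  unique_extension A (nerve F).
Proof.
move=> H f; have [h [[hh fh] hu]] := H f.
exists (yoneda hh); split.
  apply: pshMor_eq => -[m|] [x hx] /=.
    by apply: monHom_eq => p; exact: agrees_hom.
  apply: sval_inj => /=.
  have [hl _] := sub_eps_long f hx.
  by rewrite (sub_eps f hx hl) // -fh.
move=> g gf.
(* Naturality at the top simplex, and below at the marked edge, recovers [g] from its value on the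
   identity of [[n]]. *)
have gN m (x : mono m n) : g (Chain m) x =
    monHom_comp (g (Chain n) (mono_id n)) (chain_map x).
  pose e : hom (Chain m : deltaE) (Chain n : deltaE) := x.
  rewrite -[RHS](mor_nat g e (mono_id n : simplexE n (Chain n))).
  by congr (g _ _); apply: mono_eq.
have gE t : sval (g Eps t) = g (Chain n) (mono_id n) (long_arrow n).
  pose w : hom (Chain 1 : deltaE) (Eps : deltaE) := mono_id 1.
  have := congr1 (fun h : monHom _ M => h arrow01) (mor_nat g w t).
  rewrite /= (_ : chain_map_fun _ _ = arrow01) ?edge_homE; last exact: arrow_eq.
  move=> <-; rewrite gN /=; rewrite (_ : chain_map_fun _ _ = long_arrow n) //.
  exact: arrow_eq.
have hg : h = g (Chain n) (mono_id n).
  apply: hu; split.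
    by rewrite -(gE tt); exact: (svalP (g Eps tt : {x | feps x tt})).
  move=> x hx; by rewrite /sub_hom -gf /= [in RHS]gN.
apply: pshMor_eq => -[m|] x /=; first by rewrite gN hg.
by apply: sval_inj; rewrite /= gE hg.
Qed.

End Extension.

(** * Horns *)

Lemma fresh_ord n (s : seq 'I_n) : size s < n -> exists j, j \notin s.
Proof.
move=> hs; apply/existsP; apply: contraLR hs; rewrite negb_exists -leqNgt.
move=> /forallP hs; rewrite -[n in n <= _]size_enum_ord.
by apply: uniq_leq_size (enum_uniq _) _ => j _; have := hs j; rewrite negbK.
Qed.

Section Horns.
Variables (F : relFrobenius) (n : nat) (i : 'I_n.+1).
Local Notation M := (frob_relMonoid F).
Local Notation in_horn p := (smem (hornE i) (a := Chain 1) (edge p)).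

Lemma edge_in_horn (p : arrow n) j :
  j != i -> j \notin [:: (sval p).1; (sval p).2] -> in_horn p.
Proof.
move=> /eqP ji; rewrite !inE negb_or => /andP[/eqP j1 /eqP j2].
by exists j => // k; case: (chain1P k) => -> /= /esym.
Qed.

(** Pigeonhole: some vertex differs from [i] and from both endpoints, and the face opposite it
    contains the edge. *)
Lemma edge_in_horn_card (p : arrow n) :
  size (undup [:: i; (sval p).1; (sval p).2]) < n.+1 -> in_horn p.
Proof.
move=> /fresh_ord[j]; rewrite mem_undup inE negb_or => /andP[].
exact: edge_in_horn.
Qed.

Lemma in_hornP (p : arrow n) : in_horn p ->
  exists2 j, j != i & j \notin [:: (sval p).1; (sval p).2].
Proof.
move=> [j /eqP ji jp]; exists j => //; rewrite !inE negb_or !(eq_sym j).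
by apply/andP; split; apply/eqP; [exact: (jp ord0) | exact: (jp ord_max)].
Qed.

Variable f : pshMor (sub_psh (hornE i)) (nerve F).
Definition horn_edge (p : arrow n) (hp : in_horn p) : M :=
  sub_hom f hp arrow01.

Lemma horn_edge_unit p hp : arrow_eta tt p -> meta tt (@horn_edge p hp).
Proof.
move=> p_unit.
have -> : @horn_edge p hp = sub_hom f hp
    (exist (fun p : chain 1 * chain 1 => p.1 <= p.2) (ord0, ord0) isT).
  by apply: sub_hom_eq; apply: arrow_eq.
exact: hom_unit.
Qed.

(** The triangle avoids [j], so it lies whole in the face opposite [j], and [f] sends it to a
    homomorphism. *)
Lemma horn_edge_mul j x y z hx hy hz :
  j != i -> j \notin [:: (sval y).1; (sval y).2; (sval x).2] ->
  arrow_mu (x, y) z ->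
  mmu (@horn_edge x hx, @horn_edge y hy) (@horn_edge z hz).
Proof.
case: x y z hx hy hz => [[b c] bc] [[a b'] ab] [[a' c'] ac] hx hy hz.
move=> /eqP ji jabc [/= bb aa cc]; subst b' a' c'.
have ht : smem (hornE i) (a := Chain 2) (triangle ab bc).
  exists j => // k; move: jabc; rewrite !inE !negb_or !(eq_sym j).
  by move=> /and3P[/eqP ja /eqP jb /eqP jc]; case: k => -[|[|[|k]]].
pose o (k : nat) : chain 2 := inord k.
have o_val k : k < 3 -> o k = k :> nat by move=> k3; rewrite inordK.
have o01 : o 0 <= o 1 by rewrite !o_val.
have o12 : o 1 <= o 2 by rewrite !o_val.
have o02 : o 0 <= o 2 by rewrite !o_val.
pose ar (k l : chain 2) (kl : k <= l) : arrow 2 := exist _ (k, l) kl.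
have -> : horn_edge hx = sub_hom f ht (ar _ _ o12).
  by apply: sub_hom_eq; apply: arrow_eq; rewrite /= !o_val.
have -> : horn_edge hy = sub_hom f ht (ar _ _ o01).
  by apply: sub_hom_eq; apply: arrow_eq; rewrite /= !o_val.
have -> : horn_edge hz = sub_hom f ht (ar _ _ o02).
  by apply: sub_hom_eq; apply: arrow_eq; rewrite /= !o_val.
by apply: (hom_mul (sub_hom f ht) (a := ar _ _ o12) (b := ar _ _ o01)).
Qed.

Lemma horn_edge_eps j p hp : j != i -> j != ord0 -> j != ord_max ->
  p = long_arrow n -> feps (@horn_edge p hp) tt.
Proof.
move=> /eqP ji /eqP j0 /eqP jn pE.
have he : smem (hornE i) (a := Eps) tt.
  exists j => // k; rewrite /long_edge /= /long_edge_fun.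
  by case: ifP => _ /esym.
have [hl] := sub_eps_long f he; congr (feps _ tt).
by apply: sub_hom_eq; rewrite chain_map_edge pE.
Qed.

Lemma agreesP h :
  agrees f h <-> forall p hp, h p = @horn_edge p hp.
Proof.
split=> [fh p hp|fh x hx].
  by rewrite -[X in h X](chain_map_edge p) (fh _ hp).
have xE : edge (chain_map_fun x arrow01) = x.
  by apply: mono_eq => k; case: (chain1P k) => ->.
have hp : in_horn (chain_map_fun x arrow01) by rewrite xE.
by rewrite (fh _ hp); apply: sub_hom_eq; rewrite chain_map_edge.
Qed.

(** A homomorphism on [[1]] is determined by its value on [arrow01], so agreement at [p] carries
    over to the identities at its endpoints. *)
Lemma agrees_subedge (h : monHom (chain_mon n) M) p hp q hq :
  h p = @horn_edge p hp ->
  (sval q).1 \in [:: (sval p).1; (sval p).2] ->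
  (sval q).2 \in [:: (sval p).1; (sval p).2] ->
  h q = @horn_edge q hq.
Proof.
move=> hpE q1 q2.
have E : monHom_comp h (chain_map (edge p)) = sub_hom f hp.
  by apply: edge_hom_ext; rewrite /= chain_map_edge hpE.
suff [r rq] : exists r : arrow 1, chain_map_fun (edge p) r = q.
  transitivity (sub_hom f hp r); first by rewrite -E /= rq.
  by apply: sub_hom_eq; rewrite rq chain_map_edge.
(* Either [q] is an identity at an end of [p], or [q = p], since the order rules out the reversed
   arrow. *)
have [/eqP q12|q12] := boolP ((sval q).1 == (sval q).2).
  move: q2; rewrite !inE => /orP[]/eqP q2.
    exists (exist _ (ord0, ord0) isT); apply: arrow_eq;
      by rewrite /= ?q12 q2.
  exists (exist _ (ord_max, ord_max) isT); apply: arrow_eq;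
      by rewrite /= ?q12 q2.
exists arrow01; rewrite chain_map_edge.
have := svalP q; have := svalP p; move: q1 q2 q12; rewrite !inE.
move=> /orP[]/eqP q1 /orP[]/eqP q2; rewrite ?q1 ?q2 ?eqxx // => q12 le1 le2.
  exact: arrow_eq.
by case/negP: q12; rewrite -val_eqE eqn_leq le1 le2.
Qed.

End Horns.

(** * Filling horns in dimensions 1, 2 and at least 3 *)

Definition arr n (a b : chain n) (ab : a <= b) : arrow n := exist _ (a, b) ab.

Lemma horn_ext_dim1 (F : relFrobenius) (i : 'I_2)
    (f : pshMor (sub_psh (hornE i)) (nerve F)) :
  exists! h : monHom (chain_mon 1) (frob_relMonoid F),
    feps (h (long_arrow 1)) tt /\ agrees f h.
Proof.
have longE : long_arrow 1 = arrow01 by exact: arrow_eq.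
rewrite longE.
(* The horn is the face opposite the other vertex [j], that is, the vertex [i] alone. *)
have [j ji jP] : exists2 j : 'I_2, j != i & forall k, k != i -> k = j.
  by case: (chain1P i) => ->; [exists ord_max | exists ord0] => // k;
    case: (chain1P k) => ->.
pose v := arr (leqnn i).
have vi : smem (hornE i) (a := Chain 1) (edge v).
  by apply: (edge_in_horn ji); rewrite !inE negb_or /= ji.
have hu : feta tt (horn_edge f vi) by exact: horn_edge_unit.
have agr (h : monHom (chain_mon 1) (frob_relMonoid F)) :
    agrees f h <-> h v = horn_edge f vi.
  rewrite agreesP; split=> [-> //|hv p hp].
  have [j' j'i] := in_hornP hp; rewrite (jP _ j'i) !inE negb_or.
  move=> /andP[p1 p2]; apply: (agrees_subedge _ hv); rewrite !inE /= orbb.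
    by apply: contraNT p1 => /jP ->.
  by apply: contraNT p2 => /jP ->.
have v_unit (h : monHom (chain_mon 1) (frob_relMonoid F)) : meta tt (h v).
  by apply: hom_unit.
(* Both conditions on [h] prescribe one value at [arrow01]: the counit element whose source
   ([i = 0]) or target ([i = 1]) is the given unit. *)
have [e ev] : exists e, forall h : monHom _ (frob_relMonoid F),
    (feps (h arrow01) tt /\ h v = horn_edge f vi) <-> h arrow01 = e.
  case: (chain1P i) => iE.
    have src (h : monHom (chain_mon 1) (frob_relMonoid F)) :
        mmu (h arrow01, h v) (h arrow01).
      by apply: hom_mul; split; rewrite /= ?iE.
    have [e he eu] := counit_with_source hu; exists e => // h.
    split=> [[hh hv]|hE].
      by apply: (counit_source_inj hh _ he eu); rewrite -hv; exact: src.
    rewrite hE; split=> //; have := src h; rewrite hE => src_h.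
    exact: (@source_unique (frob_relMonoid F) e).
  have tgt (h : monHom (chain_mon 1) (frob_relMonoid F)) :
      mmu (h v, h arrow01) (h arrow01).
    by apply: hom_mul; split; rewrite /= ?iE.
  have [e he ue] := counit_with_target hu; exists e => // h.
  split=> [[hh hv]|hE].
    by apply: (counit_target_inj hh _ he ue); rewrite -hv; exact: tgt.
  rewrite hE; split=> //; have := tgt h; rewrite hE => tgt_h.
  exact: (@target_unique (frob_relMonoid F) e).
have [h [hE hu']] := @edge_unique (frob_relMonoid F) e.
exists h; split; first by rewrite agr; apply/ev.
by move=> h'; rewrite agr => /ev /hu'.
Qed.

Lemma horn_ext_dim2 (F : relFrobenius) (i : 'I_3)
    (f : pshMor (sub_psh (hornE i)) (nerve F)) :
  i = ord0 \/ i = ord_max ->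
  exists! h : monHom (chain_mon 2) (frob_relMonoid F),
    feps (h (long_arrow 2)) tt /\ agrees f h.
Proof.
pose o1 : 'I_3 := Ordinal (isT : 1 < 3).
pose a01 := @arr 2 ord0 o1 isT; pose a12 := @arr 2 o1 ord_max isT.
have longE : long_arrow 2 = @arr 2 ord0 ord_max isT by exact: arrow_eq.
have I3P (k : 'I_3) : [\/ k = ord0, k = o1 | k = ord_max].
  by case: k => [[|[|[|//]]] hk];
    [constructor 1|constructor 2|constructor 3]; apply: val_inj.
have face0 (h : monHom (chain_mon 2) (frob_relMonoid F)) :
    mmu (h a12, h a01) (h (long_arrow 2)) by apply: hom_mul.
case=> iE; subst i.
- have h01 : smem (hornE ord0) (a := Chain 1) (edge a01).
    exact: edge_in_horn_card.
  have h02 : smem (hornE ord0) (a := Chain 1) (edge (long_arrow 2)).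
    exact: edge_in_horn_card.
  have h00 : smem (hornE ord0) (a := Chain 1) (edge (@arr 2 ord0 ord0 isT)).
    exact: edge_in_horn_card.
  (* The long edge keeps its mark in the face opposite the middle vertex, and that face belongs to
     the horn. *)
  have e02 : feps (horn_edge f h02) tt.
    by apply: (@horn_edge_eps _ _ _ f o1).
  have u0 : feta tt (horn_edge f h00) by exact: horn_edge_unit.
  have s01 : fmu (horn_edge f h01, horn_edge f h00) (horn_edge f h01).
    by apply: (@horn_edge_mul _ _ _ f ord_max).
  have s02 : fmu (horn_edge f h02, horn_edge f h00) (horn_edge f h02).
    by apply: (@horn_edge_mul _ _ _ f o1).
  have [x xE] := left_division u0 s01 s02 e02.
  have [h hE] := @triangle_hom (frob_relMonoid F) _ _ _ xE.
  have hl : h (long_arrow 2) = horn_edge f h02.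
    by have [_ _] := hE (long_arrow 2); apply.
  have h1 : h a01 = horn_edge f h01 by have [+ _ _] := hE a01; apply.
  have fh : agrees f h.
    apply/agreesP => p hp; have [j j0] := in_hornP hp.
    rewrite !inE negb_or => /andP[p1 p2].
    (* The face opposite vertex 1 is the edge 02, and the one opposite vertex 2 is the edge 01. *)
    case: (I3P j) j0 p1 p2 => -> // _ p1 p2.
      by apply: (agrees_subedge _ hl); [move: p1; case: (I3P (sval p).1)
        | move: p2; case: (I3P (sval p).2)] => ->.
    by apply: (agrees_subedge _ h1); [move: p1; case: (I3P (sval p).1)
        | move: p2; case: (I3P (sval p).2)] => ->.
  exists h; split; first by rewrite hl.
  move=> h' [eh' /agreesP fh']; move/agreesP: fh => fh.
  apply: monHom_eq => p.
  (* Only 12 is missing from the horn; its value is forced, being paired with that of 01. *)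
  have [->|hp] : p = a12 \/ smem (hornE ord0) (a := Chain 1) (edge p).
    case: p => -[a b] ab; case: (I3P a) (I3P b) ab => -> [] -> ab //;
      by [right; apply: edge_in_horn_card | left; apply: arrow_eq].
    apply: (@paired_uniquel F _ _ (h a01)).
      by exists (h (long_arrow 2)); [exact: face0 | rewrite hl].
    exists (h' (long_arrow 2)) => //.
    by rewrite (fh _ h01) -(fh' _ h01); exact: face0.
  by rewrite (fh _ hp) (fh' _ hp).
- have h12 : smem (hornE ord_max) (a := Chain 1) (edge a12).
    exact: edge_in_horn_card.
  have h02 : smem (hornE ord_max) (a := Chain 1) (edge (long_arrow 2)).
    exact: edge_in_horn_card.
  have h22 : smem (hornE ord_max) (a := Chain 1)
      (edge (@arr 2 ord_max ord_max isT)).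
    exact: edge_in_horn_card.
  have e02 : feps (horn_edge f h02) tt.
    by apply: (@horn_edge_eps _ _ _ f o1).
  have u2 : feta tt (horn_edge f h22) by exact: horn_edge_unit.
  have t12 : fmu (horn_edge f h22, horn_edge f h12) (horn_edge f h12).
    by apply: (@horn_edge_mul _ _ _ f ord0).
  have t02 : fmu (horn_edge f h22, horn_edge f h02) (horn_edge f h02).
    by apply: (@horn_edge_mul _ _ _ f o1).
  (* Mirror case: 12 and 02 share their target, and the missing edge is 01. *)
  have [y yE] := right_division u2 t12 t02 e02.
  have [h hE] := @triangle_hom (frob_relMonoid F) _ _ _ yE.
  have hl : h (long_arrow 2) = horn_edge f h02.
    by have [_ _] := hE (long_arrow 2); apply.
  have h1 : h a12 = horn_edge f h12 by have [_ + _] := hE a12; apply.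
  have fh : agrees f h.
    apply/agreesP => p hp; have [j j0] := in_hornP hp.
    rewrite !inE negb_or => /andP[p1 p2].
    case: (I3P j) j0 p1 p2 => -> // _ p1 p2.
      by apply: (agrees_subedge _ h1); [move: p1; case: (I3P (sval p).1)
        | move: p2; case: (I3P (sval p).2)] => ->.
    by apply: (agrees_subedge _ hl); [move: p1; case: (I3P (sval p).1)
        | move: p2; case: (I3P (sval p).2)] => ->.
  exists h; split; first by rewrite hl.
  move=> h' [eh' /agreesP fh']; move/agreesP: fh => fh.
  apply: monHom_eq => p.
  have [->|hp] : p = a01 \/ smem (hornE ord_max) (a := Chain 1) (edge p).
    case: p => -[a b] ab; case: (I3P a) (I3P b) ab => -> [] -> ab //;
      by [right; apply: edge_in_horn_card | left; apply: arrow_eq].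
    apply: (@paired_uniquer F (h a12)).
      by exists (h (long_arrow 2)); [exact: face0 | rewrite hl].
    exists (h' (long_arrow 2)) => //.
    by rewrite (fh _ h12) -(fh' _ h12); exact: face0.
  by rewrite (fh _ hp) (fh' _ hp).
Qed.

(** Every edge already lies in the horn, so the extension is forced; what remains is that the values
    on edges respect units, products and the counit. *)
Lemma horn_ext_dim_ge3 (F : relFrobenius) (n : nat) (i : 'I_n.+1)
    (f : pshMor (sub_psh (hornE i)) (nerve F)) :
  2 < n -> i = ord0 \/ i = ord_max ->
  exists! h : monHom (chain_mon n) (frob_relMonoid F),
    feps (h (long_arrow n)) tt /\ agrees f h.
Proof.
move=> n3 i0n.
have hp (p : arrow n) : smem (hornE i) (a := Chain 1) (edge p).
  apply: edge_in_horn_card; exact: leq_ltn_trans (size_undup _) _.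
pose e p := horn_edge f (hp p).
have emul j (x y z : arrow n) :
    j != i -> j \notin [:: (sval y).1; (sval y).2; (sval x).2] ->
    arrow_mu (x, y) z -> mmu (e x, e y) (e z).
  by move=> *; apply: (@horn_edge_mul _ _ _ f j).
have e_unit p : arrow_eta tt p -> meta tt (e p) by exact: horn_edge_unit.
have e_eps : feps (e (long_arrow n)) tt.
  have [j] : exists j, j \notin [:: ord0; ord_max : 'I_n.+1].
    by apply: fresh_ord; rewrite ltnS ltnW.
  rewrite !inE negb_or => /andP[j0 jn]; apply: (@horn_edge_eps _ _ _ f j) => //.
  by case: i0n => ->.
(* A triangle can only be missing from the horn if n = 3; it is then the face
   opposite i, and associativity in the tetrahedron identifies its edges. *)
have e_mul x y z : arrow_mu (x, y) z -> mmu (e x, e y) (e z).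
  have [/existsP[j /andP[ji jp]] xyz|/existsPn jP] := boolP [exists j : 'I_n.+1,
      (j != i) && (j \notin [:: (sval y).1; (sval y).2; (sval x).2])].
    exact: emul ji jp xyz.
  case: x y z jP => -[b c] bc [[a b'] ab] [[a' c'] ac] /= jP.
  move=> [/= bb aa cc]; subst b' a' c'.
  (* The triangle lies in no face of the horn, so [i], [a], [b], [c] exhaust the at least four
     vertices and are therefore distinct. *)
  have all_in j : j \in [:: i; a; b; c].
    by have := jP j; rewrite negb_and !negbK in_cons.
  have : uniq [:: i; a; b; c].
    apply: (leq_size_uniq (enum_uniq 'I_n.+1)); first by move=> j _.
    by rewrite size_enum_ord.
  rewrite /= !inE !negb_or andbT.
  case/and3P => /and3P[ia ib ic] /andP[nab nac] nbc.
  move: (ia) (ib) (ic) (nab) (nac) (nbc).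
  rewrite eq_sym => ai; rewrite eq_sym => bi; rewrite eq_sym => ci.
  rewrite eq_sym => nba; rewrite eq_sym => nca; rewrite eq_sym => ncb.
  case: i0n => iE; subst i.
  (* By [a <= b <= c] and distinctness, the last vertex can only be [c], so the edge from 0 to [c]
     is marked. *)
  - have cn : c = ord_max.
      have max_eq (k : 'I_n.+1) : (ord_max : 'I_n.+1) <= k -> k = ord_max.
        by move=> nk; apply/val_inj/anti_leq; rewrite nk leq_ord.
      have := all_in ord_max; rewrite !inE => /or4P[]/eqP nE //.
      - by have n0 : n = 0 := congr1 val nE; move: (n3); rewrite {1}n0.
      - by rewrite nE in max_eq; rewrite (max_eq b) ?eqxx // in nab.
      - by rewrite nE in max_eq; rewrite (max_eq c) ?eqxx // in nbc.
    pose s (k : 'I_n.+1) := @arr n ord0 k isT.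
    have m_ab : mmu (e (arr ab), e (s a)) (e (s b)).
      by apply: (emul c) => //=; rewrite !inE !negb_or ci nca ncb.
    have m_bc : mmu (e (arr bc), e (s b)) (e (s c)).
      by apply: (emul a) => //=; rewrite !inE !negb_or ai nab nac.
    have m_ac : mmu (e (arr ac), e (s a)) (e (s c)).
      by apply: (emul b) => //=; rewrite !inE !negb_or bi nba nbc.
    have eps_c : feps (e (s c)) tt.
      by rewrite (_ : s c = long_arrow n) //; apply: arrow_eq.
    (* Both [r] and the edge [ac] multiply with the edge [0a] to the marked edge [0c], so they
       coincide. *)
    have [r bc_ab r_a] := mul_assocl m_ab m_bc.
    by rewrite (@paired_uniquel F (e (arr ac)) r (e (s a))) //;
      exists (e (s c)).
  - have a0 : a = ord0.
      have min_eq (k : 'I_n.+1) : k <= (ord0 : 'I_n.+1) -> k = ord0.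
        by rewrite leqn0 => /eqP k0; apply: val_inj.
      have := all_in ord0; rewrite !inE => /or4P[]/eqP nE //.
      - by have n0 : 0 = n := congr1 val nE; move: (n3); rewrite -{1}n0.
      - by rewrite nE in min_eq; rewrite (min_eq a) ?eqxx // in nab.
      - by rewrite nE in min_eq; rewrite (min_eq b) ?eqxx // in nbc.
    pose t (k : 'I_n.+1) := @arr n k ord_max (leq_ord k).
    have m_ab : mmu (e (t b), e (arr ab)) (e (t a)).
      by apply: (emul c) => //=; rewrite !inE !negb_or ci nca ncb.
    have m_bc : mmu (e (t c), e (arr bc)) (e (t b)).
      by apply: (emul a) => //=; rewrite !inE !negb_or ai nab nac.
    have m_ac : mmu (e (t c), e (arr ac)) (e (t a)).
      by apply: (emul b) => //=; rewrite !inE !negb_or bi nba nbc.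
    have eps_a : feps (e (t a)) tt.
      by rewrite (_ : t a = long_arrow n) //; apply: arrow_eq.
    (* Dually, [r] and the edge [ac] have the same product with the edge from [c] to the last
       vertex, and it is marked. *)
    have [r bc_ab c_r] := mul_assocr m_bc m_ab.
    by rewrite (@paired_uniquer F (e (t c)) (e (arr ac)) r) //;
      exists (e (t a)).
have [h hE] : exists h : monHom (chain_mon n) (frob_relMonoid F), h =1 e.
  by exists (@MonHom (chain_mon n) (frob_relMonoid F) e e_unit e_mul).
exists h; split.
  split; first by rewrite hE.
  by apply/agreesP => p hp'; rewrite hE (Prop_irrelevance hp' (hp p)).
move=> h' [_ /agreesP fh']; apply: monHom_eq => p.
by rewrite hE (fh' p (hp p)).
Qed.

Theorem theorem5p6 (F : relFrobenius) (n : nat) (i : 'I_n.+1) :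
  1 <= n -> i = ord0 \/ i = ord_max ->
  unique_extension (hornE i) (nerve F).
Proof.
case: n i => [|[|[|n]]] i // _ hi; apply: unique_extension_nerve => f.
- exact: horn_ext_dim1.
- exact: horn_ext_dim2.
- exact: horn_ext_dim_ge3.
Qed.
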